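(* Let $c$ be a positive integer that occurs as a leg of some primitive Pythagorean triple, and let $n$ be the number of distinct prime factors of $c$ (prime factors counted without their powers). Then the total number of primitive Pythagorean triples in which $c$ occurs as a leg equals $2^{n-1}$.
   Context: A primitive Pythagorean triple is a triple $(x,y,a)$ of positive integers with $x^2+y^2=a^2$ and $\gcd(x,y,a)=1$; exactly one of the legs is odd, and by convention the odd leg is written as $x$ and the even leg as $y$, so that the triples $(x,y,a)$ and $(y,x,a)$ are not counted separately. *)

(* Defs.v *)
From mathcomp Require Import all_boot.
From mathcomp Require Import classical_sets.

Set Implicit Arguments.
Unset Strict Implicit.
Unset Printing Implicit Defensive.

Local Open Scope classical_set_scope.
Local Open Scope nat_scope.

Definition primitive_triple (x y a : nat) : bool :=
  [&& 0 < x, 0 < y, 0 < a, x ^ 2 + y ^ 2 == a ^ 2 & gcdn (gcdn x y) a == 1].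

Definition is_leg (c : nat) : Prop :=
  exists x y a : nat, primitive_triple x y a /\ (c = x \/ c = y).

(* Exactly one leg of a primitive triple is odd; requiring it to come first
   keeps (x, y, a) and (y, x, a) from being counted separately. *)
Definition triples_with_leg (c : nat) : set (nat * nat * nat) :=
  [set t | let: (x, y, a) := t in
     [/\ primitive_triple x y a, odd x, ~~ odd y & c = x \/ c = y]].

(* Main.v *)
(**
Writing an odd leg as c^2 = (a - y)(a + y), resp. an even leg as
(c/2)^2 = ((a - x)/2)((a + x)/2), the two factors are coprime, hence both are
squares t^2 < s^2, with t s = c, resp. t s = c/2 (which is even, hence t and s
have opposite parity). So the triples correspond to the unordered coprime
factorizations of an N > 1 with the same prime factors as c; such a
factorization is a splitting of the set of primes of N into two parts, and
there are 2^(n-1) of those.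
*)
Require Import Defs.
From mathcomp Require Import all_boot zify.
From mathcomp Require Import classical_sets cardinality.

Set Implicit Arguments.
Unset Strict Implicit.
Unset Printing Implicit Defensive.

Local Open Scope card_scope.
Local Open Scope classical_set_scope.
Local Open Scope nat_scope.

(** Cancelling [g = gcdn m c] leaves [m' * n = g * c' ^ 2] with [m'] coprime to [c']. Hence [m']
    divides [g]; conversely [g], a divisor of [m], is coprime to [n] and so divides [m']. *)
Lemma coprime_mul_sqr m n c :
  coprime m n -> m * n = c ^ 2 -> m = gcdn m c ^ 2.
Proof.
move=> co_mn mn; have [m0 | m_gt0] := posnP m.
  by move: mn; rewrite m0 mul0n => /esym/eqP; rewrite expn_eq0 => /andP[/eqP-> _].
have [g g_def] : exists g, g = gcdn m c by exists (gcdn m c).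
have g_gt0 : 0 < g by rewrite g_def gcdn_gt0 m_gt0.
have /dvdnP[m' m_def] : g %| m by rewrite g_def dvdn_gcdl.
have /dvdnP[c' c_def] : g %| c by rewrite g_def dvdn_gcdr.
have co' : coprime m' c'.
  by rewrite /coprime -(eqn_pmul2r g_gt0) mul1n muln_gcdl -m_def -c_def -g_def.
have m'n : m' * n = g * c' ^ 2.
  by apply/eqP; rewrite -(eqn_pmul2r g_gt0); apply/eqP; nia.
have m'g : m' %| g.
  by rewrite -(@Gauss_dvdl _ _ (c' ^ 2)) -?m'n ?dvdn_mulr // coprimeXr.
have gm' : g %| m'.
  rewrite -(@Gauss_dvdl _ _ n) ?m'n ?dvdn_mulr //.
  by apply: coprime_dvdl co_mn; rewrite m_def dvdn_mull.
by rewrite -g_def m_def (eqP (_ : m' == g)) // eqn_dvd m'g.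
Qed.

(** * Counting coprime factorizations *)

Lemma card_eq_finset (T : finType) (A : {set T}) : [set x | x \in A] #= `I_#|A|.
Proof.
have inj : {in [set x | x \in A] &, injective (index^~ (enum A))}.
  move=> x y /[!inE] xA yA.
  by move=> /(congr1 (nth x (enum A))); rewrite !nth_index ?mem_enum.
apply: card_esym; apply: card_eq_trans (inj_card_eq inj).
suff -> : [set index x (enum A) | x in [set x | x \in A]] = `I_#|A| by [].
apply/seteqP; split=> [_ [x xA <-] | i /= i_lt] /=.
  by rewrite cardE index_mem mem_enum.
case: (pickP (mem A)) => [x0 _ | A0]; last by rewrite eq_card0 in i_lt.
rewrite cardE in i_lt; exists (nth x0 (enum A) i).
  by rewrite /= -mem_enum mem_nth.
by rewrite index_uniq // enum_uniq.
Qed.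

(** The strict inequality selects one ordering of each unordered factorization; coprime factors can
    only be equal when both are 1. *)
Definition coprime_splittings (N : nat) : set (nat * nat) :=
  [set st | [/\ st.1 * st.2 = N, coprime st.1 st.2 & st.1 < st.2]].

Lemma card_coprime_splittings N : 1 < N ->
  coprime_splittings N #= `I_(2 ^ (size (primes N) - 1)).
Proof.
move=> N_gt1; have N_gt0 : 0 < N by apply: ltnW.
pose S : finType := seq_sub (primes N).
pose pi (A : {set S}) : nat_pred := [pred p | p \in [seq ssval q | q in A]].
have mem_pi (A : {set S}) (q : S) : (ssval q \in pi A) = (q \in A).
  by rewrite inE /= fintype.mem_image //; apply: val_inj.
(* [pi (~: A)] and the negation of [pi A] differ only outside the primes of [N], which do not affect
   parts of [N]. *)
have pi_part (A : {set S}) : N`_(pi (~: A)%SET) = N`_(pi A)^'.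
  apply: eq_in_partn => p; rewrite -[p \in _]/(p \in primes N) => pN.
  by rewrite -[p]/(ssval (SeqSub pN)) mem_pi finset.in_setC -mem_pi.
have part_mem (A : {set S}) (q : S) : (ssval q %| N`_(pi A)) = (q \in A).
  have := ssvalP q; rewrite mem_primes => /and3P[q_pr _ qN].
  have := primes_part (pi A) N => /(congr1 (fun s => ssval q \in s)).
  rewrite mem_primes q_pr part_gt0 /= mem_filter => ->.
  by rewrite mem_pi ssvalP andbT.
have part_inj : injective (fun A : {set S} => N`_(pi A)).
  by move=> A B eqAB; apply/setP=> q; rewrite -!part_mem eqAB.
have split_pi (A : {set S}) : N`_(pi A) * N`_(pi (~: A)%SET) = N.
  by rewrite pi_part partnC.
have co_pi (A : {set S}) : coprime N`_(pi A) N`_(pi (~: A)%SET).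
  by rewrite pi_part coprime_partC.
have split_neq (A : {set S}) : N`_(pi A) != N`_(pi (~: A)%SET).
  apply/eqP=> eqA; have := co_pi A; have := split_pi A.
  rewrite -eqA /coprime gcdnn => NN /eqP eq1.
  by move: N_gt1; rewrite -NN eq1.
(* Complementation exchanges the two factors, so [L] is half of the subsets. *)
pose L : {set {set S}} := [set A | N`_(pi A) < N`_(pi (~: A)%SET)]%SET.
have cardL : #|L| = 2 ^ (size (primes N) - 1).
  have eqC : (~: L)%SET = [set (~: A)%SET | A in L]%SET.
    apply/setP=> A; rewrite -[A in RHS]finset.setCK finset.mem_imset;
      last exact: finset.setC_inj.
    by rewrite !inE finset.setCK -leqNgt leq_eqVlt eq_sym (negPf (split_neq _)).
  have := cardsC L; rewrite eqC card_imset; last exact: finset.setC_inj.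
  have -> : #|{set S}| = 2 ^ size (primes N).
    rewrite -cardsT -powersetT card_powerset cardsT card_seq_sub //.
    exact: primes_uniq.
  (* The subtraction in the exponent is truncated, so a prime divisor of [N] is needed before
     halving. *)
  have : 0 < size (primes N).
    by rewrite -has_predT; apply/hasP; exists (pdiv N); rewrite ?pi_pdiv.
  case: (size _) => // k _; rewrite subn1 addnn -mul2n expnS => /eqP.
  by rewrite eqn_pmul2l // => /eqP.
rewrite -cardL; apply: card_eq_trans (card_eq_finset L).
have inj : {in [set A | A \in L] &,
    injective (fun A : {set S} => (N`_(pi A), N`_(pi (~: A)%SET)))}.
  by move=> A B _ _ [/part_inj].
apply: card_eq_trans (inj_card_eq inj).
suff <- : coprime_splittings N =
  [set (N`_(pi A), N`_(pi (~: A)%SET)) | A in [set A | A \in L]] by [].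
apply/seteqP; split=> [[d e] /= [de co_de lt_de] | _ [A /= AL <-]]; last first.
  by split; rewrite //=; move: AL; rewrite inE.
have [d_gt0 e_gt0] : 0 < d /\ 0 < e.
  by apply/andP; rewrite -muln_gt0 /= de.
(* Surjectivity: the primes of [d] recover [d] as a part of [N], because the cofactor [e] is coprime
   to [d]. *)
pose A : {set S} := [set q | ssval q %| d]%SET.
have dE : N`_(pi A) = d.
  transitivity N`_(\pi(d)).
    apply: eq_in_partn => p; rewrite -[p \in _]/(p \in primes N) => pN.
    rewrite -[p]/(ssval (SeqSub pN)) mem_pi inE [RHS]mem_primes d_gt0 /=.
    by move: pN; rewrite mem_primes => /andP[-> _].
  rewrite -de partnM // [X in _ * X]part_p'nat -?coprime_pi' // muln1.
  by rewrite part_pnat_id ?pnat_pi.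
have eE : N`_(pi (~: A)%SET) = e.
  by apply/eqP; rewrite -(eqn_pmul2l d_gt0) -{1}dE split_pi de.
by exists A; rewrite /= ?inE dE eE.
Qed.

Lemma coprime_splitting_sqr u v N :
  coprime u v -> u * v = N ^ 2 -> u < v ->
  exists2 ts, coprime_splittings N ts & u = ts.1 ^ 2 /\ v = ts.2 ^ 2.
Proof.
move=> co_uv uv lt_uv.
have uE := coprime_mul_sqr co_uv uv.
have vE : v = gcdn v N ^ 2.
  by apply: (@coprime_mul_sqr _ u); rewrite 1?coprime_sym // mulnC.
exists (gcdn u N, gcdn v N) => //; split=> /=.
- by apply/eqP; rewrite -(@eqn_exp2r _ _ 2) // expnMn -uE -vE uv.
- by apply: coprime_dvdl (dvdn_gcdl _ _) (coprime_dvdr (dvdn_gcdl _ _) co_uv).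
- by rewrite -(@ltn_exp2r _ _ 2) // -uE -vE.
Qed.

(** * Coprimality and parity in primitive triples *)

Lemma primitive_tripleC x y a : primitive_triple x y a = primitive_triple y x a.
Proof. by rewrite /primitive_triple addnC [gcdn x y]gcdnC andbCA. Qed.

(** The square of a common divisor of [y] and [a] divides [a ^ 2 - y ^ 2 = x ^ 2], so the divisor
    also divides [x]. *)
Lemma primitive_triple_coprime x y a : primitive_triple x y a -> coprime y a.
Proof.
move=> /and5P[x_gt0 y_gt0 a_gt0 /eqP xya /eqP gcd1].
rewrite /coprime -dvdn1 -gcd1 !dvdn_gcd dvdn_gcdl dvdn_gcdr !andbT.
rewrite -(@dvdn_pexp2r _ _ 2) // -(dvdn_addl _ (dvdn_exp2r 2 (dvdn_gcdl y a))).
by rewrite xya dvdn_exp2r ?dvdn_gcdr.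
Qed.

(** Two odd legs would make [a ^ 2] congruent to 2 modulo 4; two even legs would make 2 a common
    divisor. *)
Lemma primitive_triple_parity x y a : primitive_triple x y a -> odd x != odd y.
Proof.
move=> pt; have co := primitive_triple_coprime pt.
have /and5P[_ _ _ /eqP xya _] := pt.
apply/negP=> /eqP.
have [yo xo | ye xe] := boolP (odd y).
  have [k xk] : exists k, x = k.*2.+1 by exists x./2; lia.
  have [l yl] : exists l, y = l.*2.+1 by exists y./2; lia.
  have [r [ar|ar]] : exists r, a = r.*2 \/ a = r.*2.+1 by exists a./2; lia.
  - by move: xya; rewrite xk yl ar -!mulnn; lia.
  - by move: xya; rewrite xk yl ar -!mulnn; lia.
have ae : ~~ odd a.
  by move/(congr1 odd): xya; rewrite oddD !oddX xe (negPf ye) /= => <-.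
have : 2 %| gcdn y a by rewrite dvdn_gcd !dvdn2 ye.
by rewrite (eqP co).
Qed.

(** This makes the count of splittings applicable to [c] or [c/2], and ensures that [c/2] is even
    when [c] is. *)
Lemma is_leg_gt1_dvdn4 c : is_leg c -> 1 < c /\ (~~ odd c -> 4 %| c).
Proof.
move=> [x [y [a [pt c_xy]]]].
have {x y c_xy pt} [b pt] : exists b, primitive_triple c b a.
  case: c_xy => ->; [by exists y | exists x; by rewrite primitive_tripleC].
have parity := primitive_triple_parity pt.
have /and5P[c_gt0 b_gt0 a_gt0 /eqP cba _] := pt.
have lt_ba : b < a.
  rewrite -(@ltn_exp2r _ _ 2) // -cba.
  by rewrite -[X in X < _]add0n ltn_add2r expn_gt0 c_gt0.
split; first by nia.
move=> ce.
have [k ck] : exists k, c = k.*2 by exists c./2; lia.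
have [l bl] : exists l, b = l.*2.+1 by exists b./2; lia.
have [r ar] : exists r, a = r.*2.+1.
  exists a./2; move/(congr1 odd): cba; rewrite oddD !oddX; lia.
have ke : ~~ odd k.
  (* The equation of the triple divided by 4; products of consecutive integers are even, hence so is
     [k]. *)
  have : k ^ 2 + l * l.+1 = r * r.+1 by nia.
  move/(congr1 odd); rewrite oddD !oddM /=.
  by case: (odd k); case: (odd l); case: (odd r).
apply/dvdnP; exists k./2; lia.
Qed.

(** * Triples built from coprime factorizations, and conversely *)

(** With [a] the hypotenuse, [a + y = s ^ 2] and [a - y = t ^ 2], so a common divisor of [y] and [a]
    divides the coprime squares. *)
Lemma odd_leg_triple t s : odd (t * s) -> coprime t s -> t < s ->
  let y := (s ^ 2 - t ^ 2)./2 in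
  primitive_triple (t * s) y (s ^ 2 + t ^ 2)./2 /\ ~~ odd y.
Proof.
rewrite oddM => /andP[to so] co_ts lt_ts y.
have lt_sq : t ^ 2 < s ^ 2 by rewrite ltn_exp2r.
have t_gt0 : 0 < t by case: t to {co_ts lt_ts y lt_sq}.
have [k tk] : exists k, t = k.*2.+1 by exists t./2; lia.
have [l sl] : exists l, s = l.*2.+1 by exists s./2; lia.
have ye : y = (l * l.+1 - k * k.+1).*2 by rewrite /y; nia.
pose a := (s ^ 2 + t ^ 2)./2; rewrite -/a.
have ae : a = (l * l.+1 + k * k.+1).*2.+1 by rewrite /a; nia.
have le_kl : k * k.+1 < l * l.+1 by nia.
split; last by rewrite ye odd_double.
apply/and5P; split; [by rewrite muln_gt0; lia | by lia | by lia | |].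
  have -> : (t * s) ^ 2 = t ^ 2 * s ^ 2 by rewrite expnMn.
  have [-> ->] : s ^ 2 = a + y /\ t ^ 2 = a - y by nia.
  by rewrite -subn_sqr subnK // leq_exp2r; lia.
rewrite -dvdn1; have /eqP <- : coprime (t ^ 2) (s ^ 2) by rewrite coprimeXl ?coprimeXr.
have [-> ->] : s ^ 2 = a + y /\ t ^ 2 = a - y by nia.
set d := gcdn _ a.
have dy : d %| y by apply: dvdn_trans (dvdn_gcdl _ _) (dvdn_gcdr _ _).
have da : d %| a := dvdn_gcdr _ _.
by rewrite dvdn_gcd dvdn_sub ?dvdn_add.
Qed.

Lemma even_leg_triple t s : 0 < t -> ~~ odd (t * s) -> coprime t s -> t < s ->
  let x := s ^ 2 - t ^ 2 in
  primitive_triple x (t * s).*2 (s ^ 2 + t ^ 2) /\ odd x.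
Proof.
move=> t_gt0 ts_even co_ts lt_ts x.
have lt_sq : t ^ 2 < s ^ 2 by rewrite ltn_exp2r.
have xo : odd x.
  have : ~~ (~~ odd t && ~~ odd s).
    rewrite -!dvdn2 -dvdn_gcd (eqP co_ts) //.
  rewrite /x oddB; last exact: ltnW.
  rewrite !oddX /=.
  by move: ts_even; rewrite oddM; case: (odd t); case: (odd s).
split=> //; apply/and5P; split; [by lia | by lia | by lia | |].
  (* Substituting [s = t + z] removes the truncated subtraction. *)
  apply/eqP; rewrite /x; have [z ->] : exists z, s = t + z by exists (s - t); lia.
  have -> : (t + z) ^ 2 - t ^ 2 = z * (z + t.*2) by nia.
  nia.
set d := gcdn _ (s ^ 2 + t ^ 2).
have dx : d %| x by apply: dvdn_trans (dvdn_gcdl _ _) (dvdn_gcdl _ _).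
have da : d %| s ^ 2 + t ^ 2 := dvdn_gcdr _ _.
(* The sum and difference of [s ^ 2 + t ^ 2] and [x] only give twice the squares; [d] is odd, so the
   2 cancels. *)
have co_d2 : coprime d 2 by rewrite coprimen2; apply: dvdn_odd dx xo.
rewrite -dvdn1; have /eqP <- : coprime (t ^ 2) (s ^ 2) by rewrite coprimeXl ?coprimeXr.
rewrite dvdn_gcd -(Gauss_dvdr _ co_d2) -[d %| s ^ 2](Gauss_dvdr _ co_d2).
have -> : 2 * t ^ 2 = (s ^ 2 + t ^ 2) - x by lia.
have -> : 2 * s ^ 2 = (s ^ 2 + t ^ 2) + x by lia.
by rewrite dvdn_sub // dvdn_add.
Qed.

Lemma triples_with_odd_leg c : odd c ->
  triples_with_leg c =
  [set (c, (st.2 ^ 2 - st.1 ^ 2)./2, (st.2 ^ 2 + st.1 ^ 2)./2)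
     | st in coprime_splittings c].
Proof.
move=> co; apply/seteqP; split=> [[[x y] a] | _ [[t s] /= [ts co_ts lt_ts] <-]] /=;
  last first.
  have [] := odd_leg_triple _ co_ts lt_ts; rewrite ts // => pt ye.
  by split; [| | |left].
move=> [pt xo ye [->|cy]]; last by rewrite -cy co in ye.
have co_ya := primitive_triple_coprime pt.
have /and5P[x_gt0 y_gt0 a_gt0 /eqP xya _] := pt.
have lt_ya : y < a by rewrite -(@ltn_exp2r _ _ 2) //; nia.
have mul_x : (a - y) * (a + y) = x ^ 2 by rewrite -subn_sqr -xya addnK.
have co_uv : coprime (a - y) (a + y).
  rewrite /coprime; set d := gcdn _ _.
  have d1 : d %| a - y := dvdn_gcdl _ _.
  have d2 : d %| a + y := dvdn_gcdr _ _.
  (* [d] divides the odd number [x ^ 2], so from [2 * y] and [2 * a] it passes to [y] and [a]. *)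
  have co_d2 : coprime d 2.
    rewrite coprimen2; apply: (@dvdn_odd _ (x ^ 2)); last by rewrite oddX xo.
    by rewrite -mul_x dvdn_mulr.
  rewrite -dvdn1 -(eqP co_ya) dvdn_gcd.
  rewrite -(Gauss_dvdr _ co_d2) -[d %| a](Gauss_dvdr _ co_d2).
  have -> : 2 * y = (a + y) - (a - y) by lia.
  have -> : 2 * a = (a + y) + (a - y) by lia.
  by rewrite dvdn_sub // dvdn_add.
have [|[t s] ts /= [tE sE]] := coprime_splitting_sqr co_uv mul_x; first by lia.
by exists (t, s) => //=; rewrite -tE -sE; congr (_, _, _); lia.
Qed.

Lemma triples_with_even_leg N : 0 < N -> ~~ odd N ->
  triples_with_leg N.*2 =
  [set (st.2 ^ 2 - st.1 ^ 2, N.*2, st.2 ^ 2 + st.1 ^ 2)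
     | st in coprime_splittings N].
Proof.
move=> N_gt0 Ne; apply/seteqP; split=> [[[x y] a] | _ [[t s] /= [ts co_ts lt_ts] <-]] /=;
  last first.
  have [t_gt0 _] : 0 < t /\ 0 < s by apply/andP; rewrite -muln_gt0 ts.
  have [] := even_leg_triple t_gt0 _ co_ts lt_ts; rewrite ts // => pt xo.
  by split=> //; [rewrite odd_double | right].
move=> [pt xo ye [cx|cy]]; first by rewrite -cx odd_double in xo.
rewrite -{}cy in pt ye *.
have co_xa : coprime x a.
  by apply: (@primitive_triple_coprime N.*2); rewrite primitive_tripleC.
have /and5P[x_gt0 y_gt0 a_gt0 /eqP xya _] := pt.
have lt_xa : x < a by rewrite -(@ltn_exp2r _ _ 2) //; nia.
have ao : odd a by move/(congr1 odd): xya; rewrite oddD !oddX odd_double xo.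
(* Here [u = (a - x)/2] and [x + u = (a + x)/2]; a common divisor of the two divides both [x] and
   [a]. *)
have [u uE] : exists u, a = x + u.*2 by exists (a - x)./2; lia.
have mul_N : u * (x + u) = N ^ 2 by nia.
have co_uv : coprime u (x + u).
  rewrite /coprime; set d := gcdn _ _.
  have d1 : d %| u := dvdn_gcdl _ _.
  have d2 : d %| x + u := dvdn_gcdr _ _.
  have dx : d %| x by rewrite -(dvdn_addl _ d1).
  by rewrite -dvdn1 -(eqP co_xa) dvdn_gcd dx uE dvdn_add // -muln2 dvdn_mulr.
have [|[t s] ts /= [tE sE]] := coprime_splitting_sqr co_uv mul_N; first by lia.
by exists (t, s) => //=; rewrite -tE -sE; congr (_, _, _); lia.
Qed.

Theorem theorem3p2 (c n : nat) (c_gt0 : 0 < c) (c_leg : is_leg c)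
    (n_def : n = size (primes c)) :
  (triples_with_leg c #= `I_(2 ^ (n - 1)))%card.
Proof.
rewrite {}n_def; have [c_gt1 c_dvd4] := is_leg_gt1_dvdn4 c_leg.
have [c_odd | c_even] := boolP (odd c).
  apply: card_eq_trans (card_coprime_splittings c_gt1).
  rewrite triples_with_odd_leg //; apply: inj_card_eq.
  move=> [t s] [t' s'] /[!inE] -[/= ts _ lt] [/= ts' _ lt'] [].
  have : t ^ 2 < s ^ 2 by rewrite ltn_exp2r.
  have : t' ^ 2 < s' ^ 2 by rewrite ltn_exp2r.
  move: c_odd (c_odd); rewrite -{1}ts -ts' !oddM => /andP[to so] /andP[to' so'].
  (* All four squares are odd, so halving their sums and differences loses nothing, and these
     determine the squares. *)
  have := oddX t 2; have := oddX s 2; have := oddX t' 2; have := oddX s' 2.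
  rewrite to so to' so' /= => *.
  have /eqP : t ^ 2 = t' ^ 2 by lia.
  have /eqP : s ^ 2 = s' ^ 2 by lia.
  by rewrite !eqn_exp2r // => /eqP-> /eqP->.
have /dvdnP[k ck] := c_dvd4 c_even.
have cE : c = (k.*2).*2 by lia.
have N_gt1 : 1 < k.*2 by lia.
(* Since [c] is a multiple of 4, its half is still even and keeps the prime 2. *)
have -> : primes c = primes k.*2.
  by apply/eq_primes => p; rewrite cE -!mul2n !primesM //; lia.
apply: card_eq_trans (card_coprime_splittings N_gt1).
rewrite cE triples_with_even_leg ?odd_double //; last exact: ltnW.
apply: inj_card_eq => -[t s] [t' s'] /[!inE] -[/= ts _ lt] [/= ts' _ lt'] [].
have : t ^ 2 < s ^ 2 by rewrite ltn_exp2r.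
have : t' ^ 2 < s' ^ 2 by rewrite ltn_exp2r.
move=> *.
have /eqP : t ^ 2 = t' ^ 2 by lia.
have /eqP : s ^ 2 = s' ^ 2 by lia.
by rewrite !eqn_exp2r // => /eqP-> /eqP->.
Qed.
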